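(* There are absolute constants $c>0$ and $C>0$ such that the following holds. Let $G=(V,E,w)$ be a (finite) graph with non-negative edge weights and shortest-path metric $d_G$, and let $K\subseteq V$ be a set of $k\ge 2$ terminals. Let $\pi=(t_1,\dots,t_k)$ be an arbitrary ordering of $K$. Let $Z_1,\dots,Z_k$ be i.i.d. exponential random variables with rate $c\ln k$ (i.e. $\Pr[Z_j\ge a]=e^{-c\ln k\cdot a}$ for $a\ge0$), and set $R_j=e^{Z_j}$. Let $V_1,\dots,V_k$ be the clusters produced by the Graphic-Relaxed-Voronoi algorithm on input $(G,K,\pi,R_1,\dots,R_k)$, and let $f:V\to K$ be defined by $f(v)=t_j$ for $v\in V_j$. Then each $f^{-1}(t_j)$ induces a connected subgraph of $G$ containing $t_j$, and for all $u,v\in V$, $$\mathbb{E}\big[d_G(f(u),f(v))\big]\le C\cdot\log k\cdot d_G(u,v).$$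
   Context: For $v\in V$, $D(v)=\min_{t\in K}d_G(v,t)$. Graphic-Relaxed-Voronoi algorithm: input a weighted graph $G=(V,E,w)$, terminals $K$, an ordering $\pi=(t_1,\dots,t_k)$ of $K$, and magnitudes $R_1,\dots,R_k\ge 1$. Initialize the set of unclustered vertices $V_\perp=V\setminus K$. For $j=1,\dots,k$ in order: build the cluster $V_j$ as follows. Set $V_j=\{t_j\}$, $U=\emptyset$, and $N=$ the set of neighbors of $t_j$ in $V_\perp$. While $N\neq\emptyset$: remove an arbitrary vertex $v$ from $N$; if $d_G(v,t_j)\le R_j\cdot D(v)$, add $v$ to $V_j$ and add to $N$ all neighbors of $v$ lying in $V_\perp\setminus(U\cup V_j)$; otherwise add $v$ to $U$. After the loop, set $V_\perp\leftarrow V_\perp\setminus V_j$. The sets $V_1,\dots,V_k$ form a partition of $V$ with each $G[V_j]$ connected and containing $t_j$. The connected metric 0-extension problem asks for a distribution over retractions $f:V\to K$ (maps with $f(t)=t$ for $t\in K$) whose clusters $f^{-1}(t_j)$ are connected, minimizing the expected distortion $\alpha$ with $\mathbb{E}[d_G(f(u),f(v))]\le\alpha\, d_G(u,v)$ for all $u,v$. *)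

(* Defs.v *)
From HB Require Import structures.
From mathcomp Require Import all_boot all_order all_algebra.
From mathcomp Require Import all_classical all_reals all_analysis.

Set Implicit Arguments.
Unset Strict Implicit.
Unset Printing Implicit Defensive.

Import Order.TTheory GRing.Theory Num.Theory.

Local Open Scope ring_scope.

Record wgraph (R : realType) (V : finType) := WGraph {
  edge : rel V;
  weight : V -> V -> R;
  edge_sym : symmetric edge;
  edge_irr : irreflexive edge;
  weight_sym : forall u v, edge u v -> weight u v = weight v u;
  weight_ge0 : forall u v, edge u v -> 0 <= weight u v }.

Definition connected_graph (R : realType) (V : finType) (G : wgraph R V) :=
  forall u v, connect (edge G) u v.

Definition induced_connected (R : realType) (V : finType) (G : wgraph R V)
    (A : {set V}) :=
  forall u v, u \in A -> v \in A ->
    connect [rel x y | [&& x \in A, y \in A & edge G x y]] u v.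

(* Total weight of the walk [u :: p]. *)
Fixpoint walk_weight (R : realType) (V : finType) (G : wgraph R V)
    (u : V) (p : seq V) : R :=
  if p is x :: p' then weight G u x + walk_weight G x p' else 0.

(* The infimum is attained (by a simple path) as soon as v is reachable from u;
   it is the junk value 0 otherwise. *)
Definition dist (R : realType) (V : finType) (G : wgraph R V) (u v : V) : R :=
  inf [set walk_weight G u p | p in
        [set p : seq V | path (edge G) u p /\ last u p = v]]%classic.

(* A minimum, since K is finite, whenever K is nonempty. *)
Definition dist_terminals (R : realType) (V : finType) (G : wgraph R V)
    (K : {set V}) (v : V) : R :=
  inf [set dist G v t | t in [set` K]]%classic.

Definition terminal_ordering (V : finType) (K : {set V}) (k : nat)
    (t : 'I_k -> V) :=
  injective t /\ [set t j | j : 'I_k] = K.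

(* [cluster_loop G ok Vbot C U N C'] : started with current cluster C, rejected
   vertices U and queue N, some execution of the while loop ends with cluster
   C'.  The vertex removed from N is arbitrary, hence a relation. *)
Inductive cluster_loop (R : realType) (V : finType) (G : wgraph R V)
    (ok : pred V) (Vbot : {set V}) :
    {set V} -> {set V} -> {set V} -> {set V} -> Prop :=
| cluster_stop (C U : {set V}) : cluster_loop G ok Vbot C U finset.set0 C
| cluster_add (C U N : {set V}) (v : V) (C' : {set V}) :
    v \in N -> ok v ->
    cluster_loop G ok Vbot (v |: C) U
      ((N :\ v) :|: [set x in Vbot :\: (U :|: (v |: C)) | edge G v x]) C' ->
    cluster_loop G ok Vbot C U N C'
| cluster_reject (C U N : {set V}) (v : V) (C' : {set V}) :
    v \in N -> ~~ ok v ->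
    cluster_loop G ok Vbot C (v |: U) (N :\ v) C' ->
    cluster_loop G ok Vbot C U N C'.

Definition create_cluster (R : realType) (V : finType) (G : wgraph R V)
    (K Vbot : {set V}) (tj : V) (Rj : R) (C : {set V}) :=
  cluster_loop G (fun v => dist G v tj <= Rj * dist_terminals G K v) Vbot
    [set tj] finset.set0 [set x in Vbot | edge G tj x] C.

(* [Vs] is a possible output of Graphic-Relaxed-Voronoi; [Vbot j] is the set of
   unclustered vertices before round j (rounds are numbered from 0). *)
Definition graphic_relaxed_voronoi (R : realType) (V : finType)
    (G : wgraph R V) (K : {set V}) (k : nat) (t : 'I_k -> V)
    (Rs : 'I_k -> R) (Vs : 'I_k -> {set V}) :=
  exists Vbot : nat -> {set V},
    Vbot 0%N = ~: K /\
    forall j : 'I_k,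
      create_cluster G K (Vbot j) (t j) (Rs j) (Vs j) /\
      Vbot j.+1 = Vbot j :\: Vs j.

(* [f v = t j] for v in [Vs j].  A vertex in no cluster is sent to itself; when
   all magnitudes are at least 1 there is no such vertex. *)
Definition cluster_map (V : finType) (k : nat) (t : 'I_k -> V)
    (Vs : 'I_k -> {set V}) (v : V) : V :=
  if [pick j | v \in Vs j] is Some j then t j else v.

Definition mutually_independent (R : realType) (d : measure_display)
    (T : measurableType d) (P : probability T R) (I : finType)
    (X : I -> {RV P >-> R}) :=
  forall (J : {set I}) (A : I -> set R),
    (forall i, measurable (A i)) ->
    (P (\bigcap_(i in [set` J]) X i @^-1` A i)%classic =
     \prod_(i in J) P (X i @^-1` A i)%classic)%E.

Definition exponential_rv (R : realType) (d : measure_display)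
    (T : measurableType d) (P : probability T R) (X : {RV P >-> R})
    (rate : R) :=
  forall A : set R, measurable A -> distribution P X A = exponential_prob rate A.

(* Main.v *)
(* Given the earlier clusters, the cluster of round j depends on R_j = e^(Z_j)
   only, and it grows with R_j.  For an edge {x, y} of weight w, put m = min(D x, D y)
   and eta = 2w/m: as soon as one end joins at level z, the other joins at level
   z + eta, so by memorylessness the round that first takes one of them separates
   them with probability at most (c ln k) eta.  If they are separated, their
   images are at distance at most w + M (D x + D y) with M = max_j R_j.

   M is not independent of the separation.  It is therefore dominated by a sum of
   indicators of rays {Z_i >= n}.  A given history of clusters followed by a
   separation in round j, intersected with such a ray, is a product event, and so
   the memoryless estimate holds on each ray separately.  Summing costs only the
   factor E[M] = O(1). *)

Require Import Defs.
From HB Require Import structures.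
From mathcomp Require Import all_boot all_order all_algebra.
From mathcomp Require Import all_classical all_reals all_analysis.
From mathcomp Require Import measurable_realfun ring lra.

Set Implicit Arguments.
Unset Strict Implicit.
Unset Printing Implicit Defensive.

Import Order.TTheory GRing.Theory Num.Theory.
Import numFieldNormedType.Exports.

Local Open Scope ring_scope.

(** * Distances *)

Section Distance.
Variables (R : realType) (V : finType) (G : wgraph R V).
Implicit Types (u v x : V) (p q : seq V).

Lemma walk_weight_cat u p q :
  walk_weight G u (p ++ q) = walk_weight G u p + walk_weight G (last u p) q.
Proof. by elim: p u => [|x p IH] u /=; rewrite ?add0r // IH addrA. Qed.

Lemma walk_weight_ge0 u p : path (edge G) u p -> 0 <= walk_weight G u p.
Proof.
elim: p u => [|x p IH] u //= /andP[ux /IH]; apply: addr_ge0.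
exact: weight_ge0.
Qed.

Lemma dist_le_walk u p :
  path (edge G) u p -> dist G u (last u p) <= walk_weight G u p.
Proof.
move=> pth; apply: ge_inf; last by exists p.
by exists 0 => _ [q [/walk_weight_ge0 + _] <-].
Qed.

Lemma dist_le_edge u v : edge G u v -> dist G u v <= weight G u v.
Proof. by move=> uv; have := @dist_le_walk u [:: v]; rewrite /= uv addr0; exact. Qed.

Hypothesis conn : connected_graph G.

(** Connectedness supplies a walk, so the infimum is over a nonempty set and is not the default
    value 0. *)
Lemma le_distP (r : R) u v :
  (forall p, path (edge G) u p -> last u p = v -> r <= walk_weight G u p) ->
  r <= dist G u v.
Proof.
move=> H; apply: lb_le_inf.
  by have /connectP[p pth ->] := conn u v; exists (walk_weight G u p), p.
by move=> _ [p [pth pv] <-]; exact: H.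
Qed.

Lemma dist_ge0 u v : 0 <= dist G u v.
Proof. by apply: le_distP => p /walk_weight_ge0. Qed.

Lemma distxx u : dist G u u = 0.
Proof. by apply/le_anti; rewrite dist_ge0 (@dist_le_walk u [::]). Qed.

Lemma dist_triangle v u x : dist G u x <= dist G u v + dist G v x.
Proof.
rewrite -lerBlDr; apply: le_distP => p up pv; rewrite lerBlDr -lerBlDl.
apply: le_distP => q vq qx; rewrite lerBlDl.
have := @dist_le_walk u (p ++ q).
by rewrite cat_path up pv vq last_cat pv qx walk_weight_cat pv; exact.
Qed.

Lemma dist_sym u v : dist G u v = dist G v u.
Proof.
suff H x y : dist G y x <= dist G x y by apply/le_anti; rewrite !H.
(* Induction along the walk with the triangle inequality replaces the reversal of the walk. *)
apply: le_distP => p; elim: p x => [|z p IH] x /=.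
  by move=> _ <-; rewrite distxx.
move=> /andP[xz zp] py; apply: le_trans (dist_triangle z _ _) _.
rewrite addrC lerD ?IH // (weight_sym xz) dist_le_edge //.
by rewrite edge_sym.
Qed.

Variable K : {set V}.
Hypothesis K0 : (0 < #|K|)%N.
Local Notation D := (dist_terminals G K).

Lemma dist_terminals_le v s : s \in K -> D v <= dist G v s.
Proof.
move=> sK; apply: ge_inf; last by exists s.
by exists 0 => _ [x _ <-]; exact: dist_ge0.
Qed.

Lemma le_dist_terminalsP (r : R) v :
  (forall s, s \in K -> r <= dist G v s) -> r <= D v.
Proof.
move=> H; apply: lb_le_inf; last by move=> _ [s sK <-]; exact: H.
by have /card_gt0P[s sK] := K0; exists (dist G v s), s.
Qed.

Lemma dist_terminals_ge0 v : 0 <= D v.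
Proof. by apply: le_dist_terminalsP => s _; exact: dist_ge0. Qed.

Lemma dist_terminals_eq0 s : s \in K -> D s = 0.
Proof.
move=> sK; apply/le_anti; rewrite dist_terminals_ge0 andbT.
by rewrite -(distxx s) dist_terminals_le.
Qed.

Lemma dist_terminals_edge u v : edge G u v -> D u <= D v + weight G u v.
Proof.
move=> uv; rewrite -lerBlDr; apply: le_dist_terminalsP => s sK.
rewrite lerBlDr addrC; apply: le_trans (dist_terminals_le _ sK) _.
by apply: le_trans (dist_triangle v _ _) _; rewrite lerD2r dist_le_edge.
Qed.

End Distance.

(** * The clusters *)

(** Only the head of each edge is tested, so the start [s], a terminal outside [Vbot], still belongs
    to the set. *)
Definition reach (R : realType) (V : finType) (G : wgraph R V) (ok : pred V)
    (Vbot : {set V}) (s : V) : {set V} :=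
  [set x | connect [rel a b | [&& edge G a b, b \in Vbot & ok b]] s x].

(* The arbitrary choices of the queue do not matter. *)
Lemma cluster_loop_reach (R : realType) (V : finType) (G : wgraph R V)
    (ok : pred V) (Vbot : {set V}) (s : V) (C : {set V}) :
  cluster_loop G ok Vbot [set s] finset.set0 [set x in Vbot | edge G s x] C ->
  C = reach G ok Vbot s.
Proof.
set C0 := [set s]; set U0 := finset.set0; set N0 := (X in cluster_loop _ _ _ _ _ X).
(* Five loop invariants follow. The last one says that a neighbour in [Vbot] of a cluster vertex
   lies in the cluster, in [U] or in the queue; once the queue is empty, the cluster is closed under
   accepted edges. *)
have inC0 : s \in C0 by rewrite inE.
have subC0 : C0 \subset reach G ok Vbot s.
  by apply/fintype.subsetP => x; rewrite !inE => /eqP ->; exact: connect0.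
have notU0 : forall x, x \in U0 -> ~~ ok x by move=> x; rewrite inE.
have inN0 : forall x, x \in N0 -> x \in Vbot /\ exists2 y, y \in C0 & edge G y x.
  by move=> x; rewrite inE => /andP[-> sx]; split => //; exists s; rewrite ?inE.
have nbr0 : forall x y, x \in C0 -> edge G x y -> y \in Vbot ->
    y \in C0 :|: U0 :|: N0.
  by move=> x y; rewrite !inE => /eqP -> -> ->; rewrite !orbT.
move=> H; elim: H inC0 subC0 notU0 inN0 nbr0 => {C C0 U0 N0}.
- move=> C U sC subC notU _ nbr; apply/eqP; rewrite finset.eqEsubset subC /=.
  apply/fintype.subsetP => x; rewrite inE => /connectP[p pth ->].
  elim: p s sC pth {subC} => [|y p IH] a aC //= /andP[/and3P[ay yV oky] /IH].
  apply; have := nbr _ _ aC ay yV; rewrite !inE orbF => /orP[//|/notU].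
  by rewrite oky.
- move=> C U N v C' vN okv _ IH sC subC notU inN nbr; apply: IH => //.
  + by rewrite inE sC orbT.
  + apply/fintype.subsetP => x; rewrite !inE.
    case/orP=> [/eqP ->|/(fintype.subsetP subC)]; last first.
      by rewrite inE.
    have [vV [y /(fintype.subsetP subC)]] := inN _ vN; rewrite inE => sy yv.
    by apply: connect_trans sy (connect1 _); rewrite /= yv vV.
  + move=> x; rewrite !inE => /orP[/andP[_ /inN[xV [y yC yx]]]|].
      by split => //; exists y; rewrite // inE yC orbT.
    by case/andP=> /andP[_ ->] vx; split => //; exists v; rewrite ?inE ?eqxx.
  + move=> x y; rewrite !inE => /orP[/eqP -> vy yV|xC xy yV].
      by rewrite vy yV; case: (y \in U); case: (y == v); case: (y \in C);
        rewrite ?orbT ?andbT.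
    have := nbr _ _ xC xy yV; rewrite !inE.
    by case: (y \in C); case: (y \in U); case: (y \in N); case: (y == v);
      rewrite ?orbT.
- move=> C U N v C' vN nokv _ IH sC subC notU inN nbr; apply: IH => //.
  + by move=> x; rewrite !inE => /orP[/eqP ->|/notU].
  + by move=> x; rewrite !inE => /andP[_ /inN].
  + move=> x y xC xy yV; have := nbr _ _ xC xy yV; rewrite !inE.
    by case: (y \in C); case: (y \in U); case: (y \in N); case: (y == v);
      rewrite ?orbT.
Qed.

Definition exp_cluster (R : realType) (V : finType) (G : wgraph R V)
    (K Vbot : {set V}) (s : V) (z : R) : {set V} :=
  reach G (fun v => dist G v s <= expR z * dist_terminals G K v) Vbot s.

Definition unclustered (V : finType) (K : {set V}) (k : nat)
    (Vs : 'I_k -> {set V}) (n : nat) : {set V} :=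
  [set x in ~: K | [forall l : 'I_k, (l < n)%N ==> (x \notin Vs l)]].

Lemma unclusteredP (V : finType) (K : {set V}) (k : nat)
    (Vs : 'I_k -> {set V}) (n : nat) (x : V) :
  reflect (x \notin K /\ forall l : 'I_k, (l < n)%N -> x \notin Vs l)
    (x \in unclustered K Vs n).
Proof.
rewrite !inE; apply: (iffP andP) => -[xK H]; split => //.
  by move=> l ln; have /forallP/(_ l) := H; rewrite ln.
by apply/forallP => l; apply/implyP; exact: H.
Qed.

Lemma eq_unclustered (V : finType) (K : {set V}) (k : nat)
    (Vs Vs' : 'I_k -> {set V}) (n : nat) :
  (forall l : 'I_k, (l < n)%N -> Vs l = Vs' l) ->
  unclustered K Vs n = unclustered K Vs' n.
Proof.
move=> H; apply/setP => x; apply/unclusteredP/unclusteredP => -[xK xV];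
  by split => // l ln; first [rewrite -H | rewrite H] => //; exact: xV.
Qed.

(** Eliminates both the queue and [Vbot]: a run becomes a system of equations on [Vs] alone, in
    which cluster [j] depends on earlier clusters and on [z j]. *)
Lemma graphic_relaxed_voronoi_clusterE (R : realType) (V : finType)
    (G : wgraph R V) (K : {set V}) (k : nat) (t : 'I_k -> V) (z : 'I_k -> R)
    (Vs : 'I_k -> {set V}) :
  graphic_relaxed_voronoi G K t (fun j => expR (z j)) Vs ->
  forall j, Vs j = exp_cluster G K (unclustered K Vs j) (t j) (z j).
Proof.
move=> [Vbot [Vbot0 step]] j.
have VbotE n : (n <= k)%N -> Vbot n = unclustered K Vs n.
  elim: n => [_|n IH nk].
    by rewrite Vbot0; apply/setP => x; rewrite finset.in_setC;
      apply/idP/unclusteredP => [|[]].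
  have [_ ->] := step (Ordinal nk); rewrite /= IH ?(ltnW nk) //.
  apply/setP => x; rewrite finset.in_setD; apply/andP/unclusteredP.
    move=> [xn /unclusteredP[xK xV]]; split => // l; rewrite ltnS leq_eqVlt.
    case/predU1P=> [ln|/xV //]; apply: contra xn.
    by rewrite (_ : Ordinal nk = l) //; exact/val_inj.
  move=> [xK xV]; split; first exact: xV.
  by apply/unclusteredP; split => // l ln; apply: xV; exact: ltnW.
have [/cluster_loop_reach -> _] := step j.
by rewrite VbotE // ltnW.
Qed.

(** * Dependence of one cluster on its level *)

Section Cluster.
Variables (R : realType) (V : finType) (G : wgraph R V).
Hypothesis conn : connected_graph G.
Variables (K : {set V}).
Hypothesis K0 : (0 < #|K|)%N.
Local Notation D := (dist_terminals G K).
Implicit Types (W : {set V}) (s x y u v : V) (z : R).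

Lemma exp_cluster_center W s z : s \in exp_cluster G K W s z.
Proof. by rewrite inE connect0. Qed.

Lemma exp_cluster_sub W s z x :
  x \in exp_cluster G K W s z -> x = s \/ x \in W.
Proof.
rewrite inE => /connectP[p]; elim/last_ind: p => [_ ->|p y _]; first by left.
rewrite rcons_path last_rcons => /andP[_ /= /and3P[_ yW _]] ->; by right.
Qed.

Lemma exp_cluster_dist W s z x :
  x \in exp_cluster G K W s z -> dist G x s <= expR z * D x.
Proof.
rewrite inE => /connectP[p]; elim/last_ind: p => [_ ->|p y _].
  by rewrite distxx // mulr_ge0 ?expR_ge0 // dist_terminals_ge0.
by rewrite rcons_path last_rcons => /andP[_ /= /and3P[]] _ _ + ->.
Qed.

Lemma exp_cluster_step W s z x y :
  x \in exp_cluster G K W s z -> edge G x y -> y \in W ->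
  dist G y s <= expR z * D y -> y \in exp_cluster G K W s z.
Proof.
rewrite !inE => sx xy yW yz; apply: (connect_trans sx (connect1 _)).
by rewrite /= xy yW.
Qed.

(** Since [D] is nonnegative, a higher level only relaxes the acceptance test. *)
Lemma exp_cluster_homo W s z z' x : z <= z' ->
  x \in exp_cluster G K W s z -> x \in exp_cluster G K W s z'.
Proof.
move=> zz'; rewrite !inE; move: s x.
suff H s x y : edge G x y -> y \in W -> dist G y s <= expR z * D y ->
    dist G y s <= expR z' * D y.
  move=> s x; apply: connect_sub (x) => a b /= /and3P[ab bW bz].
  by apply: connect1; rewrite /= ab bW (H s a).
move=> _ _ bz; apply: (le_trans bz).
by rewrite ler_wpM2r ?ler_expR // dist_terminals_ge0.
Qed.

(* [d(y, s) <= e^z (D y + w) + w <= e^z (D y + 2 w) <= e^(z + eta) D y], the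
   second step because [e^z >= 1]. *)
Lemma exp_cluster_edge W s z eta x y :
  0 <= z -> 0 <= eta -> edge G x y -> y \in W ->
  2 * weight G x y <= eta * D y ->
  x \in exp_cluster G K W s z -> y \in exp_cluster G K W s (z + eta).
Proof.
move=> z0 eta0 xy yW Heta xz.
have w0 := weight_ge0 xy.
have ez1 : 1 <= expR z by rewrite -expR0 ler_expR.
apply: (exp_cluster_step _ xy yW).
  by apply: (exp_cluster_homo _ xz); rewrite lerDl.
apply: (le_trans (dist_triangle conn x _ _)).
have dyx : dist G y x <= weight G x y by rewrite dist_sym // dist_le_edge.
have dxs := exp_cluster_dist xz.
have DxDy := dist_terminals_edge conn K0 xy.
have e1 : 1 + eta <= expR eta by exact: expR_ge1Dx.
rewrite expRD.
have : expR z * (1 + eta) * D y <= expR z * expR eta * D y.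
  by rewrite ler_wpM2r ?dist_terminals_ge0 // ler_wpM2l // expR_ge0.
have : expR z * D x <= expR z * (D y + weight G x y).
  by rewrite ler_wpM2l // expR_ge0.
have : weight G x y <= expR z * weight G x y by rewrite ler_peMl.
have : expR z * (2 * weight G x y) <= expR z * (eta * D y).
  by rewrite ler_wpM2l // expR_ge0.
nra.
Qed.

End Cluster.

(** The minimum of the positive values, capped at 1 in case there are none. *)
Lemma finite_gt0_lower_bound (R : realDomainType) (I : finType) (g : I -> R) :
  exists2 e, 0 < e & forall i, 0 < g i -> e <= g i.
Proof.
exists (\big[Num.min/1]_(i | 0 < g i) g i).
  by apply: lt_bigmin.
by move=> i gi; exact: bigmin_le_cond.
Qed.

(** * Deterministic properties of a run *)

Section Outcome.
Variables (R : realType) (V : finType) (G : wgraph R V).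
Hypothesis conn : connected_graph G.
Variables (K : {set V}) (k : nat) (t : 'I_k -> V).
Hypotheses (k0 : (0 < k)%N) (tK : terminal_ordering K t).
Variables (z : 'I_k -> R) (Vs : 'I_k -> {set V}).
Hypothesis VsE :
  forall j, Vs j = exp_cluster G K (unclustered K Vs j) (t j) (z j).
Local Notation D := (dist_terminals G K).
Local Notation f := (cluster_map t Vs).

Let tjK j : t j \in K.
Proof. by have [_ <-] := tK; exact: imset_f. Qed.

Let K0 : (0 < #|K|)%N.
Proof. by apply/card_gt0P; exists (t (Ordinal k0)). Qed.

Lemma cluster_center j : t j \in Vs j.
Proof. by rewrite VsE exp_cluster_center. Qed.

(** Besides its center, a cluster takes only vertices outside the earlier clusters; the centers are
    distinct terminals, which are never unclustered. *)
Lemma cluster_disjoint i j x : x \in Vs i -> x \in Vs j -> i = j.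
Proof.
suff H (a b : 'I_k) : (a < b)%N -> x \in Vs a -> x \in Vs b -> a = b.
  have [ij xi xj|ji xi xj|ij _ _] := ltngtP i j; first exact: H.
    by apply/esym/H.
  exact: val_inj.
move=> ab xa; rewrite VsE => /exp_cluster_sub[xtb|]; last first.
  by move=> /unclusteredP[_ /(_ a ab)]; rewrite xa.
move: xa; rewrite VsE => /exp_cluster_sub[xta|]; last first.
  by move=> /unclusteredP[]; rewrite xtb tjK.
by have [t_inj _] := tK; apply: t_inj; rewrite -xta.
Qed.

Lemma cluster_mapE j x : x \in Vs j -> f x = t j.
Proof.
move=> xj; rewrite /cluster_map; case: pickP => [i xi|/(_ j)]; last by rewrite xj.
by rewrite (cluster_disjoint xi xj).
Qed.

Lemma cluster_map_preim j : [set x | f x == t j] = Vs j.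
Proof.
apply/setP => x; rewrite inE; apply/eqP/idP => [|/cluster_mapE //].
rewrite /cluster_map; case: pickP => [i xi tij|/(_ j) + xE].
  by have [t_inj _] := tK; rewrite -(t_inj _ _ tij).
(* The default value cannot interfere: a vertex sent to itself and equal to [t j] would lie in
   [Vs j]. *)
by rewrite xE cluster_center.
Qed.

(** It suffices to join each vertex to the center. Every prefix of an accepted walk ends in the
    cluster, so the whole walk stays inside it. *)
Lemma cluster_induced_connected j : induced_connected G (Vs j).
Proof.
set e := [rel x y | [&& x \in Vs j, y \in Vs j & edge G x y]].
have e_sym : connect_sym e.
  by apply: sym_connect_sym => x y; rewrite /= edge_sym andbCA.
suff H x : x \in Vs j -> connect e (t j) x.
  by move=> x y /H tx /H; apply: connect_trans; rewrite e_sym.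
have sub y : connect [rel a b | [&& edge G a b, b \in unclustered K Vs j &
    dist G b (t j) <= expR (z j) * D b]] (t j) y -> y \in Vs j.
  by rewrite VsE inE.
rewrite VsE inE => /connectP[p + ->]; elim/last_ind: p => [|p y IH]; first by [].
rewrite rcons_path last_rcons => /andP[pth ely]; have := IH pth.
move/connect_trans; apply; apply: connect1; move: (ely) => /= /and3P[-> _ _].
rewrite !sub //.
  by apply/connectP; exists (rcons p y); rewrite ?last_rcons // rcons_path pth.
by apply/connectP; exists p.
Qed.

Lemma cluster_dist j x : x \in Vs j -> dist G x (t j) <= expR (z j) * D x.
Proof. by rewrite VsE => /(exp_cluster_dist conn K0). Qed.

Section Large.
Hypothesis z0 : forall j, 0 <= z j.

(* If the set [S] of vertices left over were nonempty, every edge from [y] in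
   [S] to [x] outside would satisfy [D y < D x + weight y x], because [y] was
   rejected by the cluster of [x].  Hence no walk from [S] to a terminal would
   have length close to the distance to the terminals. *)
Lemma cluster_cover x : exists j, x \in Vs j.
Proof.
apply: contrapT => Hx.
pose S : {set V} := [set y | [forall j, y \notin Vs j]].
have xS : x \in S.
  by rewrite inE; apply/forallP => j; apply/negP => xj; apply: Hx; exists j.
pose gap (yx : V * V) := D yx.2 + weight G yx.1 yx.2 - D yx.1.
have [e e0 He] := finite_gt0_lower_bound gap.
have gapS a b : edge G a b -> a \in S -> b \notin S -> D a + e <= weight G a b + D b.
  move=> ab; rewrite !inE => /forallP aS; rewrite negb_forall => /existsP[i].
  rewrite negbK => bi.
  suff : e <= gap (a, b) by rewrite /gap /=; lra.
  apply: He; rewrite /gap /=.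
  have aU : a \in unclustered K Vs i.
    apply/unclusteredP; split => [|l _]; last exact: aS.
    apply/negP; have [_ <-] := tK => /imsetP[j _ aE].
    by have := aS j; rewrite aE cluster_center.
  have : ~~ (dist G a (t i) <= expR (z i) * D a).
    apply: contra (aS i) => ai; rewrite VsE.
    by apply: (@exp_cluster_step _ _ _ _ _ _ _ b); rewrite -?VsE // edge_sym.
  (* With [w] the weight of the edge, e^z D a < d(a, t_i) <= w + e^z D b <= e^z (w + D b), so the
     gap is positive. *)
  rewrite -ltNge => H1; have H2 := cluster_dist bi.
  have H3 := dist_triangle conn b a (t i); have H4 := dist_le_edge ab.
  have w0 := weight_ge0 ab.
  have ez1 : 1 <= expR (z i) by rewrite -expR0 ler_expR.
  have H5 : weight G a b <= expR (z i) * weight G a b by rewrite ler_peMl.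
  have : 0 < expR (z i) * (D b + weight G a b - D a).
    by rewrite mulrBr mulrDr; lra.
  by rewrite pmulr_rgt0 // expR_gt0.
have walkS y p : path (edge G) y p -> y \in S -> last y p \in K ->
    D y + e <= walk_weight G y p.
  elim: p y => [|a p IH] y /=.
    move=> _; rewrite inE => /forallP yS; have [_ <-] := tK => /imsetP[j _ yE].
    by have := yS j; rewrite yE cluster_center.
  move=> /andP[ya ap] yS pK.
  have [aS|aS] := boolP (a \in S).
    have := IH _ ap aS pK; have := dist_terminals_edge conn K0 ya; lra.
  have := gapS _ _ ya yS aS; have := dist_le_walk ap.
  have := dist_terminals_le conn a pK; lra.
suff : D x + e <= D x by lra.
apply: le_dist_terminalsP => // s sK; apply: le_distP => // p xp ps.
by apply: walkS => //; rewrite ps.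
Qed.

Lemma cluster_map_in x : f x \in K.
Proof. by have [j /cluster_mapE ->] := cluster_cover x. Qed.

(** Follow [f x], [x], [y], [f y]; each vertex is within [S] times its [D] of its image. *)
Lemma dist_cluster_map_le x y (S : R) :
  edge G x y -> (forall j, expR (z j) <= S) ->
  dist G (f x) (f y) <= weight G x y + S * (D x + D y).
Proof.
move=> xy zS.
have fS v : dist G v (f v) <= S * D v.
  have [j vj] := cluster_cover v; rewrite (cluster_mapE vj).
  apply: (le_trans (cluster_dist vj)).
  by rewrite ler_wpM2r // dist_terminals_ge0.
have := dist_triangle conn x (f x) (f y).
have := dist_triangle conn y x (f y).
have := dist_le_edge xy; have := fS x; have := fS y.
rewrite (dist_sym conn x (f x)); lra.
Qed.

(** The round is the earlier of the two that take [x] and [y]: both ends are unclustered before it,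
    and by disjointness it takes only one. *)
Lemma cluster_map_neq x y : x \notin K -> y \notin K -> f x != f y ->
  exists j : 'I_k, [/\ x \in unclustered K Vs j, y \in unclustered K Vs j &
    (x \in Vs j) != (y \in Vs j)].
Proof.
have before v (j i : 'I_k) : v \notin K -> v \in Vs i -> (j <= i)%N ->
    v \in unclustered K Vs j.
  move=> vK vi ji; apply/unclusteredP; split => // l lj; apply/negP => vl.
  by move: (leq_trans lj ji); rewrite (cluster_disjoint vi vl) ltnn.
move=> xK yK; have [i xi] := cluster_cover x; have [j yj] := cluster_cover y.
rewrite (cluster_mapE xi) (cluster_mapE yj) => tij.
have ij : i != j by apply: contra tij => /eqP ->.
have [le_ij|/ltnW le_ji] := leqP i j.
  exists i; rewrite (before _ _ i) ?(before _ _ j) // xi; split => //.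
  rewrite eq_sym eqb_id; apply/negP => /(cluster_disjoint yj)/esym/eqP.
  exact/negP.
exists j; rewrite (before _ _ i) ?(before _ _ j) // yj; split => //.
by rewrite eqb_id; apply/negP => /(cluster_disjoint xi)/eqP; exact/negP.
Qed.

End Large.

End Outcome.

(** * Exponential magnitudes *)

Section Exponential.
Variables (R : realType) (rate : R).
Hypothesis rate_gt0 : 0 < rate.
Local Open Scope classical_set_scope.

Let cexp : continuous (fun z : R^o => expR (- rate * z)).
Proof.
move=> z; apply: continuous_comp; last exact: continuous_expR.
by apply: continuousM => //; apply: (@continuousN _ R^o); exact: cst_continuous.
Qed.

Lemma exponential_prob_itvcy (a : R) : 0 <= a ->
  exponential_prob rate `[a, +oo[ = (expR (- rate * a))%:E.
Proof.
move=> a0; rewrite /exponential_prob.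
have sub : (`[a, +oo[ : set R) `<=` `[0, +oo[.
  by move=> x /=; rewrite !in_itv /= !andbT; exact: le_trans.
rewrite (@ge0_continuous_FTC2y _ _ (fun x => - expR (- rate * x)) a 0) //.
- by rewrite EFinN oppeK add0e.
- by move=> x _; apply: exponential_pdf_ge0; exact: ltW.
- by apply: (continuous_subspaceW sub); exact: within_continuous_exponential_pdf.
- rewrite -oppr0; apply: cvgN.
  rewrite (_ : (fun x => expR (- rate * x)) =
      (fun z => expR (- z)) \o (fun z => rate * z)); last first.
    by apply: eq_fun => x; rewrite mulNr.
  apply: (@cvg_comp _ _ _ _ _ _ (pinfty_nbhs R)); last exact: cvgr_expR.
  exact: gt0_cvgMry.
- by apply: cvgN; apply/cvg_at_right_filter; exact: cexp.
- move=> z; rewrite in_itv /= andbT => az; apply: derive1_exponential_pdf.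
  by rewrite in_itv /= andbT (le_lt_trans a0).
Qed.

Lemma exponential_prob_itvoy (a : R) : 0 <= a ->
  exponential_prob rate `]a, +oo[ = (expR (- rate * a))%:E.
Proof.
move=> a0; rewrite -exponential_prob_itvcy // /exponential_prob.
rewrite integral_itv_obnd_cbnd //; apply/measurable_EFinP/measurable_funTS.
exact: measurable_exponential_pdf.
Qed.

(* The memoryless property: [N] consists of points of the up-set [S] at
   distance at most [eta] from its infimum. *)
Lemma exponential_prob_bottom_le (N S : set R) (eta : R) :
  0 <= eta -> measurable N -> measurable S -> N `<=` S -> S `<=` `[0, +oo[ ->
  (forall x y, S x -> x <= y -> S y) ->
  (forall x y, S x -> N y -> y <= x + eta) ->
  (exponential_prob rate N <= (rate * eta)%:E * exponential_prob rate S)%E.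
Proof.
move=> eta0 mN mS NS S0 Sup Nbot.
have N_le0 : exponential_prob rate set0 = 0%E :> \bar R.
  by rewrite /exponential_prob integral_set0.
(* The empty set is treated apart, its infimum being a default value. *)
have [S_eq0|/set0P[s Ss]] := eqVneq S set0.
  have -> : N = set0 by apply/seteqP; split => // x /NS; rewrite S_eq0.
  by rewrite S_eq0 N_le0 mule0.
have S_lb : lbound S 0 by move=> x /S0; rewrite /= in_itv /= andbT.
pose m := inf S.
have m0 : 0 <= m by apply: lb_le_inf => //; exists s.
have SU : `]m, +oo[ `<=` S.
  move=> y; rewrite /= in_itv /= andbT => my.
  have [x Sx xy] := inf_lt (ex_intro _ s Ss) my.
  by apply: (Sup x) => //; exact: ltW.
have Nlow : N `<=` `[m, +oo[.
  move=> y /NS Sy; rewrite /= in_itv /= andbT; apply: ge_inf => //.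
  by exists 0.
have NU : [disjoint N & `]m + eta, +oo[]%classic.
  apply/disj_setPS => y [Ny]; rewrite /= in_itv /= andbT ltNge; apply/negP.
  rewrite negbK -lerBlDr; apply: lb_le_inf; first by exists s.
  by move=> x Sx; rewrite lerBlDr; exact: Nbot.
pose P := exponential_prob rate.
(* [N] and the ray beyond [m + eta] are disjoint parts of the ray from [m]. *)
have PN : (P N + P `](m + eta)%R, +oo[ <= P `[m, +oo[)%E.
  rewrite -measureU //; last exact/disj_set2P.
  apply: le_measure; rewrite ?inE //.
    exact: measurableU.
  move=> y [/Nlow //|]; rewrite /= !in_itv /= !andbT => my.
  by apply: ltW; apply: le_lt_trans my; rewrite lerDl.
have PS : ((expR (- rate * m))%:E <= P S)%E.
  by rewrite -exponential_prob_itvoy //; apply: le_measure; rewrite ?inE.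
rewrite /P exponential_prob_itvcy // exponential_prob_itvoy ?addr_ge0 // in PN.
have c0 : 0 <= rate * eta by rewrite mulr_ge0 // ltW.
apply: (@le_trans _ _ ((rate * eta)%:E * (expR (- rate * m))%:E)%E); last first.
  by rewrite lee_wpmul2l // lee_fin.
rewrite -leeBrDr // in PN; apply: (le_trans PN).
rewrite -EFinB -EFinM lee_fin mulrDr expRD.
(* This is 1 - e^(- rate eta) <= rate eta, which bounds the mass of the interval by a multiple of
   that of the ray. *)
have e1 : 1 + - rate * eta <= expR (- rate * eta) by exact: expR_ge1Dx.
have : expR (- rate * m) * (1 + - rate * eta) <=
    expR (- rate * m) * expR (- rate * eta).
  by rewrite ler_wpM2l ?expR_ge0.
lra.
Qed.
End Exponential.

(** * Product events in independent exponential variables *)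

Section Boxes.
Variables (R : realType) (d : measure_display) (T : measurableType d).
Variables (P : probability T R) (k : nat) (Z : 'I_k -> {RV P >-> R}) (rate : R).
Hypothesis rate_gt0 : 0 < rate.
Hypothesis Z_indep : mutually_independent Z.
Hypothesis Z_exp : forall j, exponential_rv (Z j) rate.
Local Open Scope classical_set_scope.

(** The order hypotheses of [exponential_prob_bottom_le], bundled because they survive intersecting
    both sets with a ray. *)
Definition bottom_part (eta : R) (N S : set R) :=
  [/\ N `<=` S, S `<=` `[0, +oo[, (forall x y, S x -> x <= y -> S y) &
    (forall x y, S x -> N y -> y <= x + eta)].

Definition box (A : 'I_k -> set R) : set T := [set w | forall l, A l (Z l w)].

Lemma boxE A : box A = \bigcap_(i in [set` [set: 'I_k]%SET]) Z i @^-1` A i.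
Proof.
by apply/seteqP; split => w wA l => [_|]; [exact: wA|apply: wA; rewrite /= inE].
Qed.

Lemma measurable_box A : (forall l, measurable (A l)) -> measurable (box A).
Proof.
move=> mA; rewrite boxE; apply: fin_bigcap_measurable; first exact: finite_finset.
by move=> l _; rewrite -[X in measurable X]setTI; exact: measurable_funP.
Qed.

Lemma prob_box A : (forall l, measurable (A l)) ->
  P (box A) = (\prod_l exponential_prob rate (A l))%E.
Proof.
move=> mA; rewrite boxE Z_indep //; apply: eq_big => [l|l _]; first by rewrite inE.
by rewrite -(Z_exp l).
Qed.

(** By independence both probabilities are products, which differ only in the factor [j]. *)
Lemma prob_box_bottom_le (j : 'I_k) (N S : 'I_k -> set R) (eta : R) :
  0 <= eta -> (forall l, measurable (N l)) -> (forall l, measurable (S l)) ->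
  (forall l, l != j -> N l = S l) -> bottom_part eta (N j) (S j) ->
  (P (box N) <= (rate * eta)%:E * P (box S))%E.
Proof.
move=> eta0 mN mS NS [NSj S0 Sup Nbot].
rewrite !prob_box // (bigD1 j) //= [in leRHS](bigD1 j) //= muleA.
rewrite (eq_bigr (fun l => exponential_prob rate (S l))) => [|l lj].
  apply: lee_wpmul2r; last exact: exponential_prob_bottom_le.
  by apply: prode_ge0 => l _; exact: measure_ge0.
by rewrite NS.
Qed.

Definition ray (i : 'I_k) (a : R) : set T := [set w | a <= Z i w].

Lemma prob_ray i a : 0 <= a -> P (ray i a) = (expR (- rate * a))%:E.
Proof.
move=> a0; rewrite -exponential_prob_itvcy // -(Z_exp i) //=.
by congr (P _); apply/seteqP; split => w; rewrite /= in_itv /= andbT.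
Qed.

Lemma measurable_ray i a : measurable (ray i a).
Proof.
have -> : ray i a = setT `&` Z i @^-1` `[a, +oo[.
  by rewrite setTI; apply/seteqP; split => w; rewrite /= in_itv /= andbT.
exact: measurable_funP.
Qed.

(** Cutting a box by the ray changes only coordinate [i], so it stays a box and the one-box estimate
    applies. The larger boxes, being disjoint, have cut probabilities adding up to at most that of
    the ray. *)
Lemma prob_bigcup_box_bottom_le (I : finType) (act : pred I) (j : I -> 'I_k)
    (N S : I -> 'I_k -> set R) (eta : R) (i : 'I_k) (a : R) :
  0 <= eta ->
  (forall x l, act x -> measurable (N x l)) ->
  (forall x l, act x -> measurable (S x l)) ->
  (forall x l, act x -> l != j x -> N x l = S x l) ->
  (forall x, act x -> bottom_part eta (N x (j x)) (S x (j x))) ->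
  (forall x y w, act x -> act y -> box (S x) w -> box (S y) w -> x = y) ->
  (P ((\bigcup_(x in [set` act]) box (N x)) `&` ray i a) <=
    (rate * eta)%:E * P (ray i a))%E.
Proof.
move=> eta0 mN mS NS bot disj.
pose cut (A : 'I_k -> set R) l := if l == i then A l `&` `[a, +oo[ else A l.
have box_cut A : box A `&` ray i a = box (cut A).
  apply/seteqP; split => w.
    move=> [wA wa] l; rewrite /cut; case: eqP => [->|_]; last exact: wA.
    by split; [exact: wA|rewrite /= in_itv /= andbT].
  move=> wA; split => [l|].
    by have := wA l; rewrite /cut; case: eqP => // _ [].
  by have := wA i; rewrite /cut eqxx => -[_]; rewrite /= in_itv /= andbT.
have mcut A : (forall l, measurable (A l)) -> forall l, measurable (cut A l).
  by move=> mA l; rewrite /cut; case: eqP => // _; apply: measurableI.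
have c0 : (0 <= (rate * eta)%:E)%E by rewrite lee_fin mulr_ge0 // ltW.
have NS_sub x : act x -> box (N x) `<=` box (S x).
  move=> actx w wN l; have [-> |lj] := eqVneq l (j x); last by rewrite -NS.
  by have [NSj _ _ _] := bot x actx; apply: NSj; exact: wN.
have mbox (M : I -> 'I_k -> set R) x : (forall x l, act x -> measurable (M x l)) ->
    [set` act] x -> measurable (box (M x) `&` ray i a).
  move=> mM actx; apply: measurableI; last exact: measurable_ray.
  by apply: measurable_box => l; exact: mM.
rewrite setI_bigcupl measure_fin_bigcup //=; last 2 first.
- move=> x y actx acty [w [[wx _] [wy _]]].
  by apply: (disj _ _ w) => //; exact: NS_sub.
- by move=> x; exact: mbox.
rewrite -(bigfs _ (r := index_enum I)) ?index_enum_uniq //; last first.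
  by move=> x; rewrite mem_index_enum.
apply: (@le_trans _ _
    (\sum_(x | act x) (rate * eta)%:E * P (box (S x) `&` ray i a))%E).
  apply: lee_sum => x actx; rewrite !box_cut.
  apply: (@prob_box_bottom_le (j x)) => //.
  - by apply: mcut => l; exact: mN.
  - by apply: mcut => l; exact: mS.
  - by move=> l lj; rewrite /cut NS.
  (* If [i] is the special coordinate, both sets are cut by the same ray, itself an up-set. *)
  - have [NSj S0 Sup Nbot] := bot x actx; rewrite /cut; case: eqP => // _.
    split.
    + by move=> z [/NSj].
    + by move=> z [/S0].
    + move=> z z' [Sz]; rewrite /= in_itv /= andbT => az zz'.
      by split; [exact: Sup zz'|rewrite /= in_itv /= andbT (le_trans az)].
    + by move=> z z' [Sz _] [Nz' _]; exact: Nbot.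
rewrite -ge0_sume_distrr => [|x _]; last exact: measure_ge0.
apply: lee_wpmul2l => //.
rewrite bigfs ?index_enum_uniq //; last by move=> x; rewrite mem_index_enum.
rewrite -measure_fin_bigcup //=; last 2 first.
- by move=> x y actx acty [w [[wx _] [wy _]]]; exact: disj wx wy.
- by move=> x; exact: mbox.
apply: le_measure; rewrite ?inE.
- by apply: fin_bigcup_measurable => // x; exact: mbox.
- exact: measurable_ray.
- by move=> w [x _ []].
Qed.

End Boxes.

(** * Separation of the ends of an edge *)

Section History.
Variables (R : realType) (V : finType) (G : wgraph R V).
Hypothesis conn : connected_graph G.
Variables (K : {set V}).
Hypothesis K0 : (0 < #|K|)%N.
Local Notation D := (dist_terminals G K).
Local Open Scope classical_set_scope.

Definition joins (W : {set V}) (s x : V) : set R :=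
  [set z | x \in exp_cluster G K W s z].

(** By monotonicity the set is an up-set of reals, hence an interval. *)
Lemma measurable_joins W s x : measurable (joins W s x).
Proof.
apply: is_interval_measurable => a b za _ c /andP[ac _].
exact: (exp_cluster_homo conn K0 ac).
Qed.

Lemma measurable_exp_cluster_eq W s (C : {set V}) :
  measurable [set z : R | exp_cluster G K W s z = C].
Proof.
rewrite (_ : [set z | _] = \bigcap_(x in [set: V])
    if x \in C then joins W s x else ~` joins W s x); last first.
  apply/seteqP; split => [z <- x _|z H].
    by rewrite /joins; case: ifPn => // /negP.
  apply/setP => x; have := H x I; rewrite /joins; case: ifPn => //= _ /negP.
  by move/negbTE.
apply: fin_bigcap_measurable => [|x _]; first exact: finite_finset.
by case: ifP => _; [|apply: measurableC]; exact: measurable_joins.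
Qed.

Variables x y : V.

(** Levels are restricted to z >= 0, where e^z >= 1 as [exp_cluster_edge] requires. *)
Definition touching (W : {set V}) (s : V) : set R :=
  `[0, +oo[ `&` (joins W s x `|` joins W s y).

Definition splitting (W : {set V}) (s : V) : set R :=
  touching W s `\` (joins W s x `&` joins W s y).

Lemma measurable_touching W s : measurable (touching W s).
Proof.
by apply: measurableI => //; apply: measurableU; exact: measurable_joins.
Qed.

Lemma measurable_splitting W s : measurable (splitting W s).
Proof.
apply: measurableD; first exact: measurable_touching.
by apply: measurableI; exact: measurable_joins.
Qed.

(** Once one end has joined at level [a], both have joined at every level from [a + eta] on, so no
    splitting level lies beyond. *)
Lemma splitting_bottom_part (W : {set V}) s (eta : R) :
  0 <= eta -> edge G x y -> x \in W -> y \in W ->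
  2 * weight G x y <= eta * D x -> 2 * weight G x y <= eta * D y ->
  bottom_part eta (splitting W s) (touching W s).
Proof.
move=> eta0 xy xW yW etax etay; split.
- by move=> z [].
- by move=> z [].
- move=> a b [a0 Ha] ab; split.
    by move: a0; rewrite /= !in_itv /= !andbT => /le_trans; exact.
  by case: Ha => Ha; [left|right]; exact: (exp_cluster_homo conn K0 ab).
- move=> a b [a0 Ha] [_ nb]; rewrite leNgt; apply/negP => /ltW ab.
  move: a0; rewrite /= in_itv /= andbT => a0; apply: nb.
  have yx : edge G y x by rewrite edge_sym.
  split; apply: (exp_cluster_homo conn K0 ab); case: Ha => Ha.
  + by apply: (exp_cluster_homo conn K0 _ Ha); rewrite lerDl.
  + by apply: (exp_cluster_edge conn K0 a0 eta0 yx) => //; rewrite (weight_sym yx).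
  + exact: (exp_cluster_edge conn K0 a0 eta0 xy).
  + by apply: (exp_cluster_homo conn K0 _ Ha); rewrite lerDl.
Qed.

Variables (k : nat) (t : 'I_k -> V).

(* A history [(j, h)] prescribes the clusters [h l] of the rounds [l < j]; it
   is normalised to [set0] from round [j] on, so that distinct histories are
   incompatible. *)
Definition history := ('I_k * {ffun 'I_k -> {set V}})%type.

Definition live (jh : history) : bool :=
  [&& [forall l : 'I_k, (jh.1 <= l)%N ==> (jh.2 l == finset.set0)],
    x \in unclustered K jh.2 jh.1 & y \in unclustered K jh.2 jh.1].

(* The magnitudes that produce the history [(j, h)] and then satisfy [E] in
   round [j] form a box, since cluster [l] depends on the previous ones and on
   the magnitude of round [l] only. *)
Definition history_box (E : {set V} -> V -> set R) (jh : history) (l : 'I_k) :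
    set R :=
  if (l < jh.1)%N then
    [set z | exp_cluster G K (unclustered K jh.2 l) (t l) z = jh.2 l]
  else if l == jh.1 then E (unclustered K jh.2 jh.1) (t jh.1) else setT.

Lemma measurable_history_box E jh l : (forall W s, measurable (E W s)) ->
  measurable (history_box E jh l).
Proof.
move=> mE; rewrite /history_box; case: ifP => _; last by case: ifP.
exact: measurable_exp_cluster_eq.
Qed.

Section Run.
Variables (z : 'I_k -> R) (Vs : 'I_k -> {set V}).
Hypothesis VsE :
  forall j, Vs j = exp_cluster G K (unclustered K Vs j) (t j) (z j).

(** Strong induction on rounds: coordinate [l] forces [h l] to be the cluster built after the
    earlier [h], which already agree with [Vs]. From round [j] on, the normalisation decides. *)
Lemma history_boxE E jh : live jh -> (forall l, history_box E jh l (z l)) ->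
  jh.2 = [ffun l : 'I_k => if (l < jh.1)%N then Vs l else finset.set0].
Proof.
case/and3P=> /forallP /= h0 _ _ H; apply/ffunP => l; rewrite ffunE.
case: ltnP => [|jl]; last by apply/eqP; move: (h0 l); rewrite jl.
have [n] := ubnP (l : nat); elim: n l => // n IH l ln lj.
have := H l; rewrite /history_box lj /= => <-; rewrite VsE.
congr (exp_cluster _ _ _ _ _); apply: eq_unclustered => m ml.
by apply: IH; [exact: leq_trans ml ln|exact: ltn_trans ml lj].
Qed.

Lemma history_box_touchingE jh : live jh ->
  (forall l, history_box touching jh l (z l)) ->
  [/\ x \in unclustered K Vs jh.1, y \in unclustered K Vs jh.1 &
    (x \in Vs jh.1) || (y \in Vs jh.1)].
Proof.
move=> jhl H; have := history_boxE jhl H; case/and3P: jhl => _ xU yU hE.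
have UE : unclustered K jh.2 jh.1 = unclustered K Vs jh.1.
  by apply: eq_unclustered => l lj; rewrite hE ffunE lj.
rewrite -UE; split => //; have := H jh.1; rewrite /history_box ltnn eqxx UE.
by rewrite VsE => -[_ [->|->]] //; rewrite orbT.
Qed.

(** The run determines [j] as the first round taking an end of the edge, and then the clusters
    before it. *)
Lemma history_box_disjoint jh jh' : live jh -> live jh' ->
  (forall l, history_box touching jh l (z l)) ->
  (forall l, history_box touching jh' l (z l)) -> jh = jh'.
Proof.
move=> L L' H H'.
have [/unclusteredP[_ xU] /unclusteredP[_ yU] xyV] := history_box_touchingE L H.
have [/unclusteredP[_ xU'] /unclusteredP[_ yU'] xyV'] := history_box_touchingE L' H'.
have jj : jh.1 = jh'.1.
  have [jj'|j'j|] := ltngtP (jh.1 : nat) jh'.1; last exact: val_inj.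
    by move: xyV; rewrite (negbTE (xU' _ jj')) (negbTE (yU' _ jj')).
  by move: xyV'; rewrite (negbTE (xU _ j'j)) (negbTE (yU _ j'j)).
rewrite [jh]surjective_pairing [jh']surjective_pairing.
by rewrite (history_boxE L H) (history_boxE L' H') jj.
Qed.

(** The history is the run itself, truncated at round [j]. *)
Lemma history_box_splitting (j : 'I_k) : 0 <= z j ->
  x \in unclustered K Vs j -> y \in unclustered K Vs j ->
  (x \in Vs j) != (y \in Vs j) ->
  exists2 jh, live jh & forall l, history_box splitting jh l (z l).
Proof.
move=> zj xU yU xyV.
pose h : {ffun 'I_k -> {set V}} :=
  [ffun l : 'I_k => if (l < j)%N then Vs l else finset.set0].
have UE (l : 'I_k) : (l <= j)%N -> unclustered K h l = unclustered K Vs l.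
  by move=> lj; apply: eq_unclustered => m ml; rewrite ffunE (leq_trans ml lj).
exists (j, h).
  rewrite /live /= UE // xU yU !andbT; apply/forallP => l; apply/implyP => jl.
  by rewrite ffunE ltnNge jl.
move=> l; rewrite /history_box /=; case: ifPn => [lj|_].
  by rewrite /= UE ?(ltnW lj) // ffunE lj -VsE.
case: eqP => // ->; rewrite UE // /splitting /touching /joins /=.
rewrite in_itv /= andbT zj -!VsE; move: xyV.
by case: (x \in Vs j); case: (y \in Vs j) => // _; split;
  [split => //; left|case|split => //; right|case].
Qed.

End Run.

End History.

(** * The expected distortion *)

Lemma ln2_ge_half (R : realType) : 2^-1 <= ln 2 :> R.
Proof.
rewrite -ler_expR lnK ?posrE //.
(* From 1 - 1/2 <= e^(-1/2) one gets e^(1/2) <= 2. *)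
have /ler_wpM2r := expR_ge1Dx (- 2^-1 : R).
move=> /(_ (expR 2^-1) (expR_ge0 _)); rewrite -expRD addNr expR0; lra.
Qed.

Lemma ln_nat_ge_half (R : realType) (k : nat) : (2 <= k)%N -> 2^-1 <= ln k%:R :> R.
Proof.
move=> k2; apply: (le_trans (ln2_ge_half R)).
by rewrite ler_ln ?posrE ?ltr0n ?ler_nat // (leq_trans _ k2).
Qed.

(** * A summable majorant of the largest magnitude *)

Section ExpSteps.
Variables (R : realType) (d : measure_display) (T : measurableType d).
Variables (P : probability T R) (k : nat) (Z : 'I_k -> {RV P >-> R}).
Local Open Scope classical_set_scope.

Definition step_height (n : nat) : R :=
  if n is 0%N then expR 1 / k%:R else expR n.+1%:R.

Lemma step_height_ge0 n : 0 <= step_height n.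
Proof. by case: n => [|n] /=; rewrite ?divr_ge0 ?expR_ge0. Qed.

(* A majorant on [C] of all the magnitudes [e^(Z j)] made of indicators of
   rays.  The factor [1 / k] at height 0 makes the sum of the lowest steps [e],
   instead of [k * e]. *)
Definition exp_steps (C : set T) (w : T) : \bar R :=
  (\sum_(0 <= n <oo)
    \sum_(i < k) ((step_height n)%:E * (\1_(C `&` ray Z i n%:R) w)%:E))%E.

Let step_ge0 C n (i : 'I_k) w :
  (0 <= (step_height n)%:E * (\1_(C `&` ray Z i n%:R) w)%:E)%E.
Proof. by rewrite -EFinM lee_fin mulr_ge0 // step_height_ge0. Qed.

Let measurable_step C n (i : 'I_k) : measurable C ->
  measurable_fun setT
    (fun w => (step_height n)%:E * (\1_(C `&` ray Z i n%:R) w)%:E)%E.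
Proof.
move=> mC; apply: measurable_funeM; apply/measurable_EFinP/measurable_indic.
by apply: measurableI => //; exact: measurable_ray.
Qed.

Lemma exp_steps_ge0 C w : (0 <= exp_steps C w)%E.
Proof. by apply: nneseries_ge0 => n _ _; apply: sume_ge0. Qed.

Lemma measurable_exp_steps C : measurable C -> measurable_fun setT (exp_steps C).
Proof.
move=> mC; apply: (@ge0_emeasurable_sum _ _ _ _ _ xpredT) => [n w _ _|n _].
  exact: sume_ge0.
by apply: emeasurable_sum => i; exact: measurable_step.
Qed.

(** The layer at the integer part [n] of [Z j w] suffices. If [n] is 0, all [k] rays contain [w] and
    their terms sum to e; otherwise the term of [j] alone is e^(n+1). *)
Lemma expR_le_steps (C : set T) (w : T) (j : 'I_k) :
  (forall i, 0 <= Z i w) -> C w -> ((expR (Z j w))%:E <= exp_steps C w)%E.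
Proof.
move=> Z0 Cw; pose n := Num.truncn (Z j w).
have /andP[nZ Zn] : n%:R <= Z j w < n.+1%:R by exact: truncn_itv.
apply: (@le_trans _ _ (\sum_(i < k) ((step_height n)%:E *
    (\1_(C `&` ray Z i n%:R) w)%:E))%E); last first.
  apply: le_trans (nneseries_lim_ge n.+1 _); last by move=> m _ _; apply: sume_ge0.
  rewrite big_nat_recr //= leeDr //; apply: sume_ge0 => m _.
  exact: sume_ge0.
apply: (@le_trans _ _ (expR n.+1%:R)%:E).
  by rewrite lee_fin ler_expR ltW.
have ind i : n%:R <= Z i w -> \1_(C `&` ray Z i n%:R) w = 1 :> R.
  by move=> H; rewrite indicE mem_set.
case: (n) nZ ind => [_|m nZ] ind.
  rewrite (eq_bigr (fun=> (expR 1 / k%:R)%:E)) => [|i _]; last first.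
    by rewrite ind ?Z0 // -EFinM mulr1.
  rewrite sumEFin lee_fin sumr_const card_ord -[leRHS]mulr_natr divfK //.
  by rewrite pnatr_eq0 -lt0n (leq_ltn_trans _ (ltn_ord j)).
rewrite (bigD1 j) //= ind // mule1 leeDl //; exact: sume_ge0.
Qed.

Hypothesis k2 : (2 <= k)%N.
Hypothesis Z_exp : forall j, exponential_rv (Z j) (4 * ln k%:R).

Lemma step_mean_le n :
  k%:R * step_height n * expR (- (4 * ln k%:R) * n%:R) <=
    expR 1 * 2 / (2 ^ (n + 1))%:R.
Proof.
have k0 : k%:R != 0 :> R by rewrite pnatr_eq0 -lt0n (leq_trans _ k2).
have lnk := ln_nat_ge_half R k2.
have ln2k : ln 2 <= ln k%:R :> R.
  by rewrite ler_ln ?posrE ?ltr0n ?ler_nat // (leq_trans _ k2).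
have two m : (2 ^ m)%:R = expR (m%:R * ln 2) :> R.
  by rewrite expRM_natl lnK ?posrE // natrX.
case: n => [|n] /=.
  rewrite mulr0 expR0 mulr1 add0n expn1 mulfK ?pnatr_eq0 //.
  by rewrite mulrC divfK.
rewrite addn1 expnSr natrM invfM mulrA [X in _ <= X]mulrAC mulfK ?pnatr_eq0 //.
rewrite two -expRN -[k%:R](@lnK R) ?posrE ?lt0r ?k0 //= -!expRD ler_expR lnK.
have n1 : 1 <= n.+1%:R :> R by rewrite ler1n.
(* Here the rate constant 4 is spent. With N = n + 1, the decay 4 N ln k pays ln k for the factor
   [k], 2 N ln k >= N for the height, and N ln k for the factor 2^N. *)
have a1 : ln k%:R <= n.+1%:R * ln k%:R :> R by rewrite ler_peMl //; lra.
have a2 : n.+1%:R * ln 2 <= n.+1%:R * ln k%:R :> R by rewrite ler_wpM2l.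
have a3 : n.+1%:R * 2^-1 <= n.+1%:R * ln k%:R :> R by rewrite ler_wpM2l.
rewrite -[n.+2%:R]natr1; lra.
by rewrite posrE lt0r k0 /=.
Qed.

(** Termwise integration: layer [n] costs at most 2 e q / 2^(n+1), a geometric series of sum 2 e
    q. *)
Lemma integral_exp_steps (C : set T) (q : R) : measurable C -> 0 <= q ->
  (forall i n, P (C `&` ray Z i n%:R) <= q%:E * P (ray Z i n%:R))%E ->
  (\int[P]_w exp_steps C w <= (2 * expR 1 * q)%:E)%E.
Proof.
move=> mC q0 CP; have rate0 : 0 < 4 * ln k%:R :> R.
  by have := ln_nat_ge_half R k2; lra.
rewrite /exp_steps integral_nneseries //; last 2 first.
- by move=> n; apply: emeasurable_sum => i; exact: measurable_step.
- by move=> n w _; exact: sume_ge0.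
have half := @cvg_geometric_eseries_half R (expR 1 * 2 * q) 0.
rewrite [X in (_ <= X)%E](_ : _ = limn (eseries (fun n =>
    (expR 1 * 2 * q / (2 ^ (n + 1))%:R)%:E))); last first.
  by rewrite (cvg_lim _ half) // expr0 divr1 (mulrC 2).
apply: lee_nneseries => [n _ _|n _].
  by apply: integral_ge0 => w _; exact: sume_ge0.
rewrite ge0_integral_sum //; last by move=> i; exact: measurable_step.
apply: (@le_trans _ _ (\sum_(i < k)
    (q * step_height n * expR (- (4 * ln k%:R) * n%:R))%:E)%E).
  apply: lee_sum => i _.
  have mCr : measurable (C `&` ray Z i n%:R).
    by apply: measurableI => //; exact: measurable_ray.
  rewrite ge0_integralZl_EFin ?step_height_ge0 //; last first.
    by apply/measurable_EFinP; exact: measurable_indic.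
  rewrite integral_indic // setIT.
  apply: (@le_trans _ _ ((step_height n)%:E * (q%:E * P (ray Z i n%:R)))%E).
    by apply: lee_wpmul2l; [rewrite lee_fin step_height_ge0|exact: CP].
  by rewrite (prob_ray rate0 Z_exp) // -!EFinM lee_fin mulrCA mulrA.
rewrite sumEFin lee_fin sumr_const card_ord -[leLHS]mulr_natl.
have := step_mean_le n; move/(ler_wpM2l q0); lra.
Qed.

End ExpSteps.

(* The output of the algorithm is an arbitrary function of the sample point, so
   [f] may fail to be measurable, which excludes [ge0_le_integral]. *)
Lemma ge0_le_integralT (d : measure_display) (T : measurableType d)
    (R : realType) (mu : {measure set T -> \bar R}) (f g : T -> \bar R) :
  (forall w, 0 <= f w)%E -> (forall w, f w <= g w)%E ->
  (\int[mu]_w f w <= \int[mu]_w g w)%E.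
Proof.
move=> f0 fg; have g0 w : (0 <= g w)%E by exact: le_trans (fg w).
rewrite !ge0_integralTE //; apply: le_ereal_sup => _ [h hf <-].
by exists h => // w; exact: le_trans (hf w) (fg w).
Qed.

(** * Expected distortion of a random run *)

Section RandomRun.
Variables (R : realType) (V : finType) (G : wgraph R V) (K : {set V}).
Variables (k : nat) (t : 'I_k -> V).
Hypotheses (conn : connected_graph G) (k2 : (2 <= k)%N).
Hypothesis tK : terminal_ordering K t.
Variables (d : measure_display) (T : measurableType d) (P : probability T R).
Variable Z : 'I_k -> {RV P >-> R}.
Hypothesis Z_indep : mutually_independent Z.
Hypothesis Z_exp : forall j, exponential_rv (Z j) (4 * ln k%:R).
Variable Vs : T -> 'I_k -> {set V}.
Hypothesis VsE : forall w j,
  Vs w j = exp_cluster G K (unclustered K (Vs w) j) (t j) (Z j w).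
Local Notation D := (dist_terminals G K).
Local Notation f w := (cluster_map t (Vs w)).
Local Open Scope classical_set_scope.

Let k0 : (0 < k)%N. Proof. exact: leq_trans k2. Qed.

Let K0 : (0 < #|K|)%N.
Proof.
by apply/card_gt0P; exists (t (Ordinal k0)); have [_ <-] := tK; exact: imset_f.
Qed.

Let lnk : 2^-1 <= ln k%:R :> R. Proof. exact: ln_nat_ge_half. Qed.

Let rate_gt0 : 0 < 4 * ln k%:R :> R. Proof. by have := lnk; lra. Qed.

(** A finite union of boxes, measurable by construction, which contains the separation of [x] and
    [y] at nonnegative levels when neither is a terminal. *)
Definition cut_event (x y : V) : set T :=
  \bigcup_(jh in [set` live K x y (k := k)])
    box Z (history_box G K t (splitting G K x y) jh).

Lemma measurable_cut_event x y : measurable (cut_event x y).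
Proof.
apply: fin_bigcup_measurable => [|jh _]; first exact: finite_finset.
apply: measurable_box => l; apply: measurable_history_box => // W s.
exact: measurable_splitting.
Qed.

Lemma prob_cut_event_le x y (eta : R) (i : 'I_k) (a : R) :
  0 <= eta -> edge G x y ->
  2 * weight G x y <= eta * D x -> 2 * weight G x y <= eta * D y ->
  (P (cut_event x y `&` ray Z i a) <=
    (4 * ln k%:R * eta)%:E * P (ray Z i a))%E.
Proof.
move=> eta0 xy etax etay.
apply: (@prob_bigcup_box_bottom_le _ _ _ _ _ _ _ rate_gt0 Z_indep Z_exp _ _ fst
  _ (history_box G K t (touching G K x y))) => //.
- move=> jh l _; apply: measurable_history_box => // W s.
  exact: measurable_splitting.
- move=> jh l _; apply: measurable_history_box => // W s.
  exact: measurable_touching.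
- by move=> jh l _ /negbTE lj; rewrite /history_box lj.
- move=> jh /and3P[_ xU yU]; rewrite /history_box ltnn eqxx.
  exact: splitting_bottom_part.
- move=> jh jh' w L L' H H'.
  exact: (history_box_disjoint (VsE w) L L' H H').
Qed.

Lemma cut_eventP x y w : (forall j, 0 <= Z j w) -> x \notin K -> y \notin K ->
  f w x != f w y -> cut_event x y w.
Proof.
move=> Zw xK yK fxy.
have [j [xU yU xyV]] := cluster_map_neq conn k0 tK (VsE w) Zw xK yK fxy.
have [jh L H] := history_box_splitting (VsE w) (Zw j) xU yU xyV.
by exists jh.
Qed.

(** The measurable [g] stands in for [X]. Domination is asked only at nonnegative levels, which have
    full probability, and such majorants add up along walks. *)
Definition majorised (X : T -> R) (c : R) :=
  exists g : T -> \bar R, [/\ measurable_fun setT g, forall w, (0 <= g w)%E,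
    forall w, (forall j, 0 <= Z j w) -> ((X w)%:E <= g w)%E &
    (\int[P]_w g w <= c%:E)%E].

Lemma majorised_edge x y : edge G x y ->
  majorised (fun w => dist G (f w x) (f w y))
    (64 * expR 1 * ln k%:R * weight G x y).
Proof.
move=> xy; have w0 := weight_ge0 xy.
have yx : edge G y x by rewrite edge_sym.
have Dx0 := dist_terminals_ge0 conn K0 x.
have Dy0 := dist_terminals_ge0 conn K0 y.
have Dxy := dist_terminals_edge conn K0 xy.
have Dyx := dist_terminals_edge conn K0 yx; rewrite (weight_sym yx) in Dyx.
have e0 := expR_ge0 (1 : R).
(* Common to both cases below, with [m] a length scale and [C] an event containing the separation.
   With M the largest magnitude, the distance is at most w + 3 M m <= 4 M m on [C], and the mean of
   the majorant is at most 4 m * 2 e q <= 64 e ln k * w. *)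
have maj (C : set T) (m q : R) : measurable C -> weight G x y <= m ->
    D x + D y <= 3 * m -> 0 <= q ->
    (forall i n, P (C `&` ray Z i n%:R) <= q%:E * P (ray Z i n%:R))%E ->
    (forall w, (forall j, 0 <= Z j w) -> f w x != f w y -> C w) ->
    m * q <= 8 * ln k%:R * weight G x y ->
    majorised (fun w => dist G (f w x) (f w y))
      (64 * expR 1 * ln k%:R * weight G x y).
  move=> mC wm Dm q0 CP fC mq; have m0 : 0 <= m by exact: le_trans wm.
  exists (fun w => (4 * m)%:E * exp_steps Z C w)%E; split.
  - by apply: measurable_funeM; exact: measurable_exp_steps.
  - by move=> w; rewrite mule_ge0 ?exp_steps_ge0 // lee_fin mulr_ge0.
  - move=> w Zw; have [fxy|/(fC w Zw) Cw] := eqVneq (f w x) (f w y).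
      rewrite fxy distxx //; rewrite mule_ge0 ?exp_steps_ge0 //.
      by rewrite lee_fin mulr_ge0.
    have [j _ jmax] : exists2 j : 'I_k, true & forall i, Z i w <= Z j w.
      have [//|j _ H] := @arg_maxP _ R _ (Ordinal k0) predT (Z^~ w).
      by exists j => // i; exact: H.
    apply: (@le_trans _ _ ((4 * m)%:E * (expR (Z j w))%:E)%E); last first.
      apply: lee_wpmul2l; first by rewrite lee_fin mulr_ge0.
      exact: expR_le_steps.
    rewrite lee_fin.
    apply: (le_trans (@dist_cluster_map_le _ _ _ conn _ _ _ k0 tK _ _ (VsE w) Zw
      _ _ (expR (Z j w)) xy _)).
      by move=> i; rewrite ler_expR.
    have ez1 : 1 <= expR (Z j w) by rewrite -expR0 ler_expR.
    have : expR (Z j w) * (D x + D y) <= expR (Z j w) * (3 * m).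
      by rewrite ler_wpM2l ?expR_ge0.
    have : m <= expR (Z j w) * m by rewrite ler_peMl.
    lra.
  - rewrite ge0_integralZl_EFin ?mulr_ge0 //; last 2 first.
    + by move=> w _; exact: exp_steps_ge0.
    + exact: measurable_exp_steps.
    apply: (@le_trans _ _ ((4 * m)%:E * (2 * expR 1 * q)%:E)%E).
      apply: lee_wpmul2l; first by rewrite lee_fin mulr_ge0.
      exact: (integral_exp_steps k2 Z_exp).
    rewrite -EFinM lee_fin; have /(ler_wpM2l e0) := mq; lra.
pose m := Num.min (D x) (D y).
(* If an end is within [w] of a terminal, separation may be certain: the whole space with q = 1
   serves, since D x + D y <= 3 w and 1 <= 8 ln k. *)
have [mw|wm] := leP m (weight G x y).
  apply: (maj setT (weight G x y) 1) => //.
  - by move: mw; rewrite /m; case: (leP (D x) (D y)); lra.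
  - by move=> i n; rewrite setTI mul1e.
  - have /(ler_wpM2r w0) := lnk; lra.
(* Otherwise m > 0, so neither end is a terminal, and eta = 2 w / m gives m q = 8 ln k * w
   exactly. *)
have m_gt0 : 0 < m by exact: le_lt_trans wm.
have /andP[mx my] : (m <= D x) && (m <= D y) by rewrite -le_min.
have notK v : m <= D v -> v \notin K.
  move=> mv; apply/negP => vK; move: mv.
  by rewrite (dist_terminals_eq0 conn K0 vK) leNgt m_gt0.
pose eta := 2 * weight G x y / m.
have eta0 : 0 <= eta by rewrite divr_ge0 ?mulr_ge0 // ltW.
have etaE : eta * m = 2 * weight G x y by rewrite /eta divfK // gt_eqF.
apply: (maj (cut_event x y) m (4 * ln k%:R * eta)) => //.
- exact: measurable_cut_event.
- exact: ltW.
- by move: wm; rewrite /m; case: (leP (D x) (D y)); lra.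
- by rewrite mulr_ge0 // ltW.
- by move=> i n; apply: prob_cut_event_le => //; rewrite -etaE ler_wpM2l.
- by move=> w Zw; apply: cut_eventP => //; exact: notK.
- by rewrite mulrCA [m * _]mulrC etaE; lra.
Qed.

Lemma majorised_walk x p : path (edge G) x p ->
  majorised (fun w => dist G (f w x) (f w (last x p)))
    (64 * expR 1 * ln k%:R * walk_weight G x p).
Proof.
elim: p x => [|y p IH] x /=.
  exists (fun=> 0%E); split => //; first by move=> w _; rewrite distxx.
  by rewrite integral0 mulr0.
move=> /andP[/majorised_edge[g [mg g0 gX gc]] /IH[h [mh h0 hX hc]]].
exists (g \+ h)%E; split.
- exact: emeasurable_funD.
- by move=> w; rewrite adde_ge0.
- move=> w Zw; apply: le_trans (leeD (gX w Zw) (hX w Zw)).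
  by rewrite -EFinD lee_fin dist_triangle.
- by rewrite ge0_integralD // mulrDr EFinD leeD.
Qed.

Lemma prob_nonneg : P (box Z (fun=> `[0, +oo[)) = 1%E.
Proof.
rewrite (prob_box Z_indep Z_exp) //.
by apply: big1 => j _; rewrite exponential_prob_itvcy // mulr0 expR0.
Qed.

(** Negative levels form a null event, on which [b] bounds [X]; adding [b] times its indicator to
    the majorant costs nothing in mean. *)
Lemma expectation_majorised_le (X : T -> R) (b c : R) :
  (forall w, 0 <= X w <= b) -> majorised X c -> ('E_P[X] <= c%:E)%E.
Proof.
move=> Xb [g [mg g0 gX gc]]; rewrite unlock.
pose bad := ~` box Z (fun=> `[0, +oo[).
have mbad : measurable bad by apply/measurableC/measurable_box.
have Pbad : P bad = 0%E.
  by rewrite probability_setC ?prob_nonneg ?subee //; exact: measurable_box.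
(* The sample space is nonempty because its probability is 1. *)
have b0 : 0 <= b.
  have /set0P[w _] : [set: T] != set0.
    apply/eqP => T0; have := probability_setT P.
    by rewrite T0 measure0 => /esym/eqP; rewrite onee_eq0.
  by have /andP[/le_trans] := Xb w; exact.
have mbad1 : measurable_fun setT (fun w => b%:E * (\1_bad w)%:E)%E.
  by apply: measurable_funeM; apply/measurable_EFinP; exact: measurable_indic.
apply: (@le_trans _ _ (\int[P]_w (g w + b%:E * (\1_bad w)%:E))%E).
  apply: ge0_le_integralT => w; first by rewrite lee_fin; have /andP[] := Xb w.
  have [wbad|wgood] := pselect (bad w).
    rewrite indicE mem_set // mule1; apply: (@le_trans _ _ b%:E); last exact: leeDr.
    by rewrite lee_fin; have /andP[] := Xb w.
  apply: (@le_trans _ _ (g w)).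
    apply: gX => j; have /contrapT/(_ j) := wgood.
    by rewrite /= in_itv /= andbT.
  by rewrite leeDl // -EFinM lee_fin mulr_ge0.
rewrite ge0_integralD //; last by move=> w _; rewrite -EFinM lee_fin mulr_ge0.
rewrite ge0_integralZl_EFin //; last first.
  by apply/measurable_EFinP; exact: measurable_indic.
have -> : (\int[P]_w (\1_bad w)%:E = 0)%E by rewrite integral_indic // setIT.
by rewrite mule0 adde0.
Qed.

End RandomRun.

Theorem theorem3 (R : realType) :
  exists c C : R, 0 < c /\ 0 < C /\
  forall (V : finType) (G : wgraph R V) (K : {set V}) (k : nat)
    (t : 'I_k -> V),
    connected_graph G -> #|K| = k -> (2 <= k)%N -> terminal_ordering K t ->
  forall (d : measure_display) (T : measurableType d) (P : probability T R)
    (Z : 'I_k -> {RV P >-> R}),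
    mutually_independent Z ->
    (forall j, exponential_rv (Z j) (c * ln k%:R)) ->
  forall Vs : T -> 'I_k -> {set V},
    (forall omega,
      graphic_relaxed_voronoi G K t (fun j => expR (Z j omega)) (Vs omega)) ->
  let f := fun omega => cluster_map t (Vs omega) in
    (forall omega, (forall j, 1 <= expR (Z j omega)) ->
      forall v, f omega v \in K) /\
    (forall omega j,
      t j \in [set v | f omega v == t j] /\
      induced_connected G [set v | f omega v == t j]) /\
    (forall u v : V,
      ('E_P[fun omega => dist G (f omega u) (f omega v)]
        <= (C * ln k%:R * dist G u v)%:E)%E).
Proof.
have e0 : 0 < expR 1 :> R by exact: expR_gt0.
exists 4, (64 * expR 1); split => //; split; first by rewrite mulr_gt0.
move=> V G K k t conn cardK k2 tK d T P Z Z_indep Z_exp Vs grv f.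
have VsE w j : Vs w j = exp_cluster G K (unclustered K (Vs w) j) (t j) (Z j w).
  exact: graphic_relaxed_voronoi_clusterE (grv w) j.
have k0 : (0 < k)%N by exact: leq_trans k2.
split; [|split].
- move=> w Zw x; apply: (cluster_map_in conn k0 tK (VsE w)) => j.
  by rewrite -ler_expR expR0.
- move=> w j; rewrite (cluster_map_preim tK (VsE w)).
  split; first exact: cluster_center (VsE w) j.
  exact: cluster_induced_connected (VsE w) j.
- move=> u v.
  have C_gt0 : 0 < 64 * expR 1 * ln k%:R :> R.
    apply: mulr_gt0; first exact: mulr_gt0.
    by apply: lt_le_trans (ln_nat_ge_half R k2); rewrite invr_gt0.
  pose b := \sum_x \sum_y dist G x y.
  have fb w : 0 <= dist G (f w u) (f w v) <= b.
    rewrite dist_ge0 //= /b (bigD1 (f w u)) //= (bigD1 (f w v)) //=.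
    rewrite -addrA lerDl addr_ge0 // sumr_ge0 // => x _; first exact: dist_ge0.
    by rewrite sumr_ge0 // => y _; exact: dist_ge0.
  have E_walk p : path (edge G) u p -> last u p = v ->
      ('E_P[fun w => dist G (f w u) (f w v)] <=
        (64 * expR 1 * ln k%:R * walk_weight G u p)%:E)%E.
    move=> up pv; apply: (expectation_majorised_le k2 Z_indep Z_exp fb).
    by rewrite -pv; exact: (majorised_walk conn k2 tK Z_indep Z_exp VsE up).
  have E_fin : 'E_P[fun w => dist G (f w u) (f w v)]%E \is a fin_num.
    have /connectP[p up pv] := conn u v.
    rewrite ge0_fin_numE; first exact: le_lt_trans (E_walk p up (esym pv)) (ltry _).
    by apply: expectation_ge0 => w; exact: dist_ge0.
  (* Dividing the finite expectation by the positive constant gives a lower bound on all walk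
     weights, hence on their infimum. *)
  rewrite -(fineK E_fin) lee_fin mulrC -ler_pdivrMr //.
  apply: le_distP => // p up pv; rewrite ler_pdivrMr // mulrC -lee_fin fineK //.
  exact: E_walk.
Qed.
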